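(* Let $n\ge 2$, $h>0$, let $x_1,\dots,x_n$ be equally spaced nodes with $x_{i+1}=x_i+h$, and let $J=[a,b]$ be a finite interval containing the nodes. Let $S_n$ be the extended rule of model A or of model B for approximating $I(f)=\int_{x_1}^{x_n} f(x)\,dx$, and let $E_{S_n}=I(f)-S_n(f)$ be its true error. Let $w_k$ denote the Newton polynomial of degree $k$. (i) If $n$ is odd and $f\in C^{n+1}(J)$, then $\deg(S_n)=n$ and there is $\xi\in J$ such that $$E_{S_n}=\frac{I(w_{n+1})}{(n+1)!}\,f^{(n+1)}(\xi).$$ (ii) If $n$ is even and $f\in C^{n}(J)$, then $\deg(S_n)=n-1$ and there is $\xi\in J$ such that $$E_{S_n}=\frac{I(w_{n})}{n!}\,f^{(n)}(\xi).$$
   Context: Model A: $S_n(f)=a_1 f(x_1)+\sum_{j=2}^{n} a_j f[x_1,\ldots,x_j]$. Model B: $S_n(f)=\sum_{j=1}^{n-1} a_j f(x_j)+a_n f[x_1,\ldots,x_n]$. In each model the weights $a_j$ (independent of $f$) are determined by requiring $S_n$ to be interpolatory, i.e. exact for all real polynomials of degree at most $n-1$. Here $f[x_1,\ldots,x_j]$ is the divided difference of order $j-1$. The degree of precision $\deg(R)$ of a rule $R$ is the largest integer $d$ such that $I(q)=R(q)$ for all real polynomials $q$ of degree at most $d$. Newton polynomials: $w_0(x)=1$, $w_k(x)=(x-x_1)(x-x_2)\cdots(x-x_k)$ for $k\ge1$, where $x_i=x_1+(i-1)h$ (also for $i=n+1$); thus $I(w_k)=\int_0^{(n-1)h} t(t-h)\cdots(t-(k-1)h)\,dt$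 for $k\ge 1$. *)

(* Defs.v *)
From HB Require Import structures.
From mathcomp Require Import all_boot all_order all_algebra.
From mathcomp Require Import all_classical all_reals all_analysis.
Import Order.TTheory GRing.Theory Num.Theory.
Import numFieldNormedType.Exports.

Set Implicit Arguments.
Unset Strict Implicit.
Unset Printing Implicit Defensive.

Local Open Scope classical_set_scope.
Local Open Scope ring_scope.

(* Nodes are indexed from 1: [node x1 h i] is x_i = x_1 + (i - 1) h, with no
   upper bound on i (x_{n+1} is used by the Newton polynomial w_{n+1}). *)
Definition node (R : realType) (x1 h : R) (i : nat) : R :=
  x1 + (i%:R - 1) * h.

(* [divdiff f x i k] is f[x_i, ..., x_{i+k}], of order k. *)
Fixpoint divdiff (R : realType) (f : R -> R) (x : nat -> R) (i k : nat) : R :=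
  match k with
  | 0%N => f (x i)
  | k'.+1 => (divdiff f x i.+1 k' - divdiff f x i k') / (x (i + k'.+1)%N - x i)
  end.

Definition newton_poly (R : realType) (x : nat -> R) (k : nat) : {poly R} :=
  \prod_(1 <= i < k.+1) ('X - (x i)%:P).

Definition integral_nodes (R : realType) (x : nat -> R) (n : nat) (f : R -> R)
    : R :=
  \int[@lebesgue_measure R]_(t in `[x 1%N, x n]) f t.

Variant model := ModelA | ModelB.

Definition extended_rule (R : realType) (m : model) (x : nat -> R) (n : nat)
    (wt : nat -> R) (f : R -> R) : R :=
  match m with
  | ModelA => wt 1%N * f (x 1%N)
              + \sum_(2 <= j < n.+1) wt j * divdiff f x 1 j.-1
  | ModelB => \sum_(1 <= j < n) wt j * f (x j) + wt n * divdiff f x 1 n.-1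
  end.

(* Recall that [size q <= d.+1] means that q has degree at most d. *)
Definition exact_upto (R : realType) (I Q : (R -> R) -> R) (d : nat) : Prop :=
  forall q : {poly R}, (size q <= d.+1)%N -> I (horner q) = Q (horner q).

Definition degree_of_precision (R : realType) (I Q : (R -> R) -> R) (d : nat)
    : Prop :=
  exact_upto I Q d /\ forall e : nat, exact_upto I Q e -> (e <= d)%N.

(* Derivatives relative to a set J (in practice a nondegenerate interval):
   one-sided at the endpoints of J, and independent of f outside J. *)
Definition diff_quot (R : realType) (f : R -> R) (x y : R) : R :=
  (f y - f x) / (y - x).

Definition derive_within (R : realType) (J : set R) (f : R -> R) (x : R) : R :=
  lim (diff_quot f x @ within J x^').

Definition derivn_within (R : realType) (J : set R) (k : nat) (f : R -> R)
    : R -> R :=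
  iter k (derive_within J) f.

Definition Cn_on (R : realType) (J : set R) (k : nat) (f : R -> R) : Prop :=
  (forall i : nat, (i < k)%N -> forall x : R, J x ->
     cvg (diff_quot (derivn_within J i f) x @ within J x^')) /\
  {within J, continuous (derivn_within J k f)}.

(* Main.v *)
Require Import Defs.
From HB Require Import structures.
From mathcomp Require Import all_boot all_order all_algebra.
From mathcomp Require Import all_classical all_reals all_analysis.
From mathcomp Require Import ring lra zify.
Import Order.TTheory GRing.Theory Num.Theory.
Import numFieldNormedType.Exports.

Set Implicit Arguments.
Unset Strict Implicit.
Unset Printing Implicit Defensive.

Local Open Scope classical_set_scope.
Local Open Scope ring_scope.


(** Both models use only the values of f at the n nodes, so exactness in degree
    n - 1 forces S_n(f) = I(p), where p interpolates f at the nodes.  The claim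
    is therefore the classical error formula for the closed Newton-Cotes rules,
    to be proved for the interpolation error I(f) - I(p).

    Let M = 2k + 1 be the odd number among n and n - 1, let W = w_M and
    N = M + 1, so that N is the order of the derivative in the conclusion for
    both parities.  Let p0 interpolate f at the first M nodes and let
    q = (f - p0) / W.  Then f - p = W (q - kappa), where kappa = 0 if n = M and
    kappa = q(x_n) if n = M + 1; similarly w_N = W (id - x_N).

    By the generalized Rolle theorem the slopes of q off the nodes are values
    of f^(N) / N! ([newton_quotient_slope]).  So if mu <= f^(N) / N! on J, then
    q - mu id is nondecreasing.  The central fact ([newton_integral_sign_ext])
    is that the integral of W (r - r_n) is nonpositive for every r that is
    nondecreasing off the nodes, where r_n is an arbitrary constant if n = M and
    is r(x_n) if n = M + 1.  Applied to r = q - mu id it gives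
    I(f) - I(p) <= mu I(w_N); an upper bound mu gives the reverse inequality in
    the same way, and r = id gives I(w_N) < 0.  Hence (I(f) - I(p)) / I(w_N)
    lies between the extrema of f^(N) / N! on J, and is attained by the
    intermediate value theorem ([interpolation_error]).

    The central fact holds because W is odd about the midpoint of
    [x_1, x_M]: folding the integral there replaces r by r(z) - r(y), with y and
    z mirror images.  This difference is nonnegative and decreases towards the
    midpoint, and |W| decreases too when y moves one step h inwards, while W
    changes sign.  So, for each fixed offset in (0, h), the contributions of the
    successive intervals form an alternating sum of decreasing terms
    ([newton_integral_sign]).  Integrals are handled through primitives and the
    mean value theorem, which turns this pointwise inequality on (0, h) into one
    between integrals.

    The degree of precision is read off from the same error formula, applied to
    polynomials: the error of a polynomial of degree at most N is its
    coefficient of degree N times I(w_N), and I(w_N) is not 0. *)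

(** * Alternating sums *)

Lemma alternating_sum_recl (R : realType) (k : nat) (b : nat -> R) :
  \sum_(i < k.+1) (-1) ^+ i * b i
  = b 0%N - \sum_(i < k) (-1) ^+ i * b i.+1.
Proof.
rewrite big_ord_recl expr0 mul1r -sumrN; congr (_ + _).
by apply: eq_bigr => i _; rewrite /bump /= exprS mulN1r mulNr.
Qed.

Lemma alternating_sum_bounds (R : realType) (k : nat) (b : nat -> R) :
  (forall i, (i <= k)%N -> 0 <= b i) ->
  (forall i, (i < k)%N -> b i.+1 <= b i) ->
  0 <= \sum_(i < k.+1) (-1) ^+ i * b i <= b 0%N.
Proof.
elim: k b => [|k IH] b b_ge0 b_noninc.
  by rewrite big_ord1 expr0 mul1r b_ge0 ?lexx.
have /andP[tail_ge0 tail_le] :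
    0 <= \sum_(i < k.+1) (-1) ^+ i * b i.+1 <= b 1%N.
  by apply: (IH (fun i => b i.+1)) => i ik; [exact: b_ge0|exact: b_noninc].
have b10 : b 1%N <= b 0%N by exact: b_noninc.
rewrite alternating_sum_recl.
by apply/andP; split; lra.
Qed.

Lemma alternating_sum_gt0 (R : realType) (k : nat) (b : nat -> R) :
  (forall i, (i <= k)%N -> 0 <= b i) ->
  (forall i, (i < k)%N -> b i.+1 <= b i) ->
  0 < b 0%N -> ((0 < k)%N -> b 1%N < b 0%N) ->
  0 < \sum_(i < k.+1) (-1) ^+ i * b i.
Proof.
case: k => [|k] b_ge0 b_noninc b0 b10; first by rewrite big_ord1 expr0 mul1r.
have /andP[_ tail_le] :
    0 <= \sum_(i < k.+1) (-1) ^+ i * b i.+1 <= b 1%N.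
  apply: (@alternating_sum_bounds R k (fun i => b i.+1)) => i ik;
    [exact: b_ge0|exact: b_noninc].
rewrite alternating_sum_recl.
by have := b10 isT; lra.
Qed.

(** * Newton polynomials at equally spaced nodes *)

(** The Newton polynomial of degree m in the coordinate u = (y - x_1) / h. *)
Definition falling (R : realType) (u : R) (m : nat) : R :=
  \prod_(j < m) (u - j%:R).

Lemma falling_recr (R : realType) (u : R) (m : nat) :
  falling u m.+1 = falling u m * (u - m%:R).
Proof. by rewrite /falling big_ord_recr. Qed.

Lemma falling_recl (R : realType) (u : R) (m : nat) :
  falling u m.+1 = u * falling (u - 1) m.
Proof.
rewrite /falling big_ord_recl subr0; congr (_ * _).
by apply: eq_bigr => j _; rewrite /bump /= -addrA -opprD -nat1r.
Qed.

(** The quotient of the values of the polynomial at points one step apart; the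
    comparison of consecutive terms of the alternating sum rests on it. *)
Lemma falling_shift (R : realType) (u : R) (m : nat) :
  falling (u + 1) m.+1 * (m%:R - u) = - ((u + 1) * falling u m.+1).
Proof. by rewrite falling_recl falling_recr addrK; ring. Qed.

Lemma falling_reflect (R : realType) (u : R) (m : nat) :
  falling (m%:R - u) m.+1 = (-1) ^+ m.+1 * falling u m.+1.
Proof.
rewrite /falling (reindex_inj rev_ord_inj) /=.
rewrite -[X in (-1) ^+ X]card_ord -prodr_const -big_split /=.
apply: eq_bigr => j _; rewrite subSS natrB; first by ring.
by rewrite -ltnS.
Qed.

Lemma falling_neg_sign (R : realType) (u : R) (m : nat) :
  u < 0 -> 0 < (-1) ^+ m * falling u m.
Proof.
move=> u_lt0; elim: m => [|m IH]; first by rewrite /falling big_ord0 mulr1.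
have -> : (-1) ^+ m.+1 * falling u m.+1
          = ((-1) ^+ m * falling u m) * (m%:R - u).
  by rewrite falling_recr exprS; ring.
by rewrite mulr_gt0 // subr_gt0 (lt_le_trans u_lt0).
Qed.

Lemma falling_gt0 (R : realType) (u : R) (m : nat) :
  m%:R < u -> 0 < falling u m.+1.
Proof.
move=> mu; apply: prodr_gt0 => j _; rewrite subr_gt0.
by apply: le_lt_trans mu; rewrite ler_nat -ltnS.
Qed.

(** On the first k of the 2k intervals, stepping from u to u + 1 multiplies the
    value by - (u + 1) / (2k - u), which is negative and, since u + 1 < k, of
    absolute value less than 1. *)
Lemma falling_alternates (R : realType) (k i : nat) (s : R) :
  0 < s < 1 -> (i < k)%N ->
  0 < (-1) ^+ i * falling (s + i%:R) k.*2.+1 /\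
  ((i.+1 < k)%N ->
     (-1) ^+ i.+1 * falling (s + i.+1%:R) k.*2.+1
     < (-1) ^+ i * falling (s + i%:R) k.*2.+1).
Proof.
move=> /andP[s0 s1].
have kE : k.*2%:R = k%:R + k%:R :> R by rewrite -addnn natrD.
(* Multiplying by 2k - (s + j) > 0 avoids the quotient of the two values. *)
have step j : (j < k)%N ->
    (-1) ^+ j.+1 * falling (s + j.+1%:R) k.*2.+1 * (k.*2%:R - (s + j%:R))
    = (s + j%:R + 1) * ((-1) ^+ j * falling (s + j%:R) k.*2.+1).
  move=> jk; rewrite -(natr1 j) addrA -mulrA falling_shift exprS; ring.
have pos j : (j < k)%N -> 0 < (-1) ^+ j * falling (s + j%:R) k.*2.+1.
  elim: j => [|j IH] jk.
    rewrite addr0 falling_recl expr0 mul1r mulr_gt0 //.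
    have := @falling_neg_sign R (s - 1) k.*2 _.
    by rewrite -mul2n exprM sqrrN expr1n expr1n mul1r; apply; lra.
  have jkR : j%:R + 1 + 1 <= k%:R :> R by rewrite !natr1 ler_nat.
  have d0 : 0 < k.*2%:R - (s + j%:R) by rewrite kE; have := ler0n R j; lra.
  rewrite -(pmulr_lgt0 _ d0) step; last exact: ltnW.
  by rewrite mulr_gt0 ?IH 1?ltnW //; have := ler0n R j; lra.
move=> ik; split=> [|i1k]; first exact: pos.
have ikR : i%:R + 1 + 1 <= k%:R :> R by rewrite !natr1 ler_nat.
have i0 := ler0n R i.
have d0 : 0 < k.*2%:R - (s + i%:R) by rewrite kE; lra.
rewrite -(ltr_pM2r d0) step // mulrC ltr_pM2l ?pos // kE; lra.
Qed.

Lemma newton_polyS (R : realType) (x : nat -> R) (m : nat) :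
  newton_poly x m.+1 = newton_poly x m * ('X - (x m.+1)%:P).
Proof. by rewrite /newton_poly big_nat_recr. Qed.

Lemma newton_poly_node (R : realType) (x1 h u : R) (m : nat) :
  (newton_poly (node x1 h) m).[x1 + u * h] = h ^+ m * falling u m.
Proof.
elim: m => [|m IH].
  by rewrite /newton_poly /falling big_geq // big_ord0 hornerC mulr1.
rewrite newton_polyS hornerM IH !hornerE falling_recr exprS /node -natr1.
by ring.
Qed.

Lemma size_newton_poly (R : realType) (x : nat -> R) (m : nat) :
  size (newton_poly x m) = m.+1.
Proof.
by rewrite /newton_poly size_prod_XsubC size_iota subn1.
Qed.

Lemma monic_newton_poly (R : realType) (x : nat -> R) (m : nat) :
  newton_poly x m \is monic.
Proof. exact: monic_prod_XsubC. Qed.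

Lemma newton_poly_eq0 (R : realType) (x : nat -> R) (m : nat) (y : R) :
  (newton_poly x m).[y] = 0 <-> exists2 i, (1 <= i <= m)%N & y = x i.
Proof.
elim: m => [|m IH].
  rewrite /newton_poly big_geq // hornerC; split=> [/eqP|[i]]; last lia.
  by rewrite oner_eq0.
rewrite newton_polyS hornerM hornerXsubC; split.
  move=> /eqP; rewrite mulf_eq0 => /orP[/eqP/IH[i im ->]|].
    by exists i => //; lia.
  by rewrite subr_eq0 => /eqP ->; exists m.+1; rewrite ?leqnn.
move=> [i im yE]; have [im1|im'] := eqVneq i m.+1.
  by rewrite yE im1 subrr mulr0.
suff -> : (newton_poly x m).[y] = 0 by rewrite mul0r.
by apply/IH; exists i => //; lia.
Qed.

(** * Primitives *)

Definition primitive_on (R : realType) (c d : R) (F g : R -> R) : Prop :=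
  {within `[c, d], continuous F} /\
  (forall t, c < t < d -> is_derive t 1 F (g t)).

Lemma primitive_on_sub (R : realType) (c d c' d' : R) (F g : R -> R) :
  c <= c' -> d' <= d -> primitive_on c d F g -> primitive_on c' d' F g.
Proof.
move=> cc' dd' [cF dF]; split=> [|t /andP[ct td]].
  apply: continuous_subspaceW cF; apply: subset_itv => //; by rewrite bnd_simp.
by apply: dF; rewrite (le_lt_trans cc' ct) (lt_le_trans td dd').
Qed.

Lemma primitive_on_eq (R : realType) (c d : R) (F g g' : R -> R) :
  (forall t, c < t < d -> g t = g' t) ->
  primitive_on c d F g -> primitive_on c d F g'.
Proof. by move=> gg' [cF dF]; split=> // t tcd; rewrite -gg' //; apply: dF. Qed.

Lemma primitive_onD (R : realType) (c d : R) (F1 F2 g1 g2 : R -> R) :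
  primitive_on c d F1 g1 -> primitive_on c d F2 g2 ->
  primitive_on c d (fun t => F1 t + F2 t) (fun t => g1 t + g2 t).
Proof.
move=> [cF1 dF1] [cF2 dF2]; split=> [t|t tcd].
  by apply: continuousD; [exact: cF1|exact: cF2].
by apply: is_deriveD; [exact: dF1|exact: dF2].
Qed.

Lemma primitive_onZ (R : realType) (c d e : R) (F g : R -> R) :
  primitive_on c d F g ->
  primitive_on c d (fun t => e * F t) (fun t => e * g t).
Proof.
move=> [cF dF]; split=> [t|t tcd].
  by apply: continuousM; [exact: cst_continuous|exact: cF].
by apply: (@is_deriveZ _ _ _ F e); exact: dF.
Qed.

Lemma primitive_on_sum (R : realType) (c d : R) (k : nat)
    (F g : nat -> R -> R) :
  (forall i, (i < k)%N -> primitive_on c d (F i) (g i)) ->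
  primitive_on c d (fun t => \sum_(i < k) F i t) (fun t => \sum_(i < k) g i t).
Proof.
elim: k => [|k IH] prim.
  have -> : (fun t => \sum_(i < 0) F i t) = cst 0.
    by apply/funext => t; rewrite big_ord0.
  split=> [t|t _]; first exact: cst_continuous.
  by rewrite big_ord0; exact: is_derive_cst.
have -> : (fun t => \sum_(i < k.+1) F i t)
          = (fun t => \sum_(i < k) F i t + F k t).
  by apply/funext => t; rewrite big_ord_recr.
apply: (@primitive_on_eq _ _ _ _ (fun t => \sum_(i < k) g i t + g k t)).
  by move=> t _; rewrite big_ord_recr.
by apply: primitive_onD; [apply: IH => i ik; apply: prim; lia|exact: prim].
Qed.

Lemma primitive_on_affine (R : realType) (a b c d p e : R) (F g : R -> R) :
  primitive_on a b F g ->
  (forall t, c <= t <= d -> a <= p + e * t <= b) ->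
  (forall t, c < t < d -> a < p + e * t < b) ->
  primitive_on c d (fun t => F (p + e * t)) (fun t => e * g (p + e * t)).
Proof.
move=> [cF dF] closed_ab open_ab.
have daff (t : R) : is_derive t 1 (fun s => p + e * s : R) e.
  have -> : (fun s => p + e * s : R) = (cst p + e \*: @id R)%R by [].
  apply: is_derive_eq.
  by rewrite add0r scaler1.
have caff : continuous (fun s => p + e * s : R).
  move=> t; apply/differentiable_continuous/derivable1_diffP.
  by case: (daff t).
split=> [|t tcd].
  apply/(@subspace_continuousP R `[c, d] R) => t; rewrite /= in_itv /= => tcd.
  have /subspace_continuousP/(_ (p + e * t)) := cF.
  rewrite /= in_itv /= => /(_ (closed_ab _ tcd)) Fcvg.
  move=> V /Fcvg nV.
  have nV' : nbhs t (fun s => (p + e * s) \in `[a, b] -> V (F (p + e * s))).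
    exact: (caff t _ nV).
  change (nbhs t (fun s => s \in `[c, d] -> V (F (p + e * s)))).
  apply: filterS nV' => s /= Vs scd.
  by apply: Vs; rewrite in_itv /= closed_ab // -in_itv.
rewrite mulrC; apply: (@is_derive1_comp _ F (fun s => p + e * s)).
exact/dF/open_ab.
Qed.

Lemma primitive_on_mvt (R : realType) (c d : R) (F g : R -> R) :
  c < d -> primitive_on c d F g ->
  exists2 t, c < t < d & F d - F c = g t * (d - c).
Proof.
move=> cd [cF dF].
have dF' t : t \in `]c, d[%R -> is_derive t 1 F (g t).
  by rewrite in_itv /=; exact: dF.
by have [t] := MVT cd dF' cF; rewrite in_itv /=; exists t.
Qed.

Lemma primitive_on_integral (R : realType) (c d : R) (g : R -> R) :
  c < d -> {within `[c, d], continuous g} ->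
  exists2 F, primitive_on c d F g &
    \int[@lebesgue_measure R]_(t in `[c, d]) g t = F d - F c.
Proof.
move=> cd cg.
have gint : (@lebesgue_measure R).-integrable `[c, d] (EFin \o g).
  by apply: continuous_compact_integrable => //; exact: segment_compact.
exists (fun s => \int[@lebesgue_measure R]_(t in `[c, s]) g t); last first.
  by rewrite set_itv1 Rintegral_set1 subr0.
split=> [|t tcd].
  exact: (parameterized_integral_continuous (ltW cd) gint).
have /andP[ct td] := tcd.
have gt : {for t, continuous g}.
  by apply: (within_continuous_continuous cd cg); rewrite in_itv /= tcd.
have [der <-] := continuous_FTC1_closed td gint ct gt.
by rewrite derive1E; exact/derivableP.
Qed.

(** * Integrals of a Newton polynomial times a monotone function *)

(** The mean value theorem for the primitive
    t |-> sum_(i < k) (F (x1 + i h + t) - F (e - i h - t)), whose increment over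
    [0, h] telescopes to F e - F x1 because both halves of [x1, e] end at the
    midpoint.  It evaluates all the subintervals at one common offset s, which
    allows the terms to be compared with each other. *)
Lemma folded_primitive (R : realType) (k : nat) (x1 h : R) (F g : R -> R) :
  0 < h -> primitive_on x1 (x1 + k.*2%:R * h) F g ->
  exists2 s, 0 < s < 1 &
    F (x1 + k.*2%:R * h) - F x1
    = h * \sum_(i < k) (g (x1 + (s + i%:R) * h)
                        + g (x1 + (k.*2%:R - (s + i%:R)) * h)).
Proof.
move=> h_gt0 primF; set e := x1 + k.*2%:R * h.
have kE : k.*2%:R = k%:R + k%:R :> R by rewrite -addnn natrD.
pose T i t := F (x1 + i%:R * h + 1 * t) + - 1 * F (e - i%:R * h + -1 * t).
pose T' i t := 1 * g (x1 + i%:R * h + 1 * t)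
               + - 1 * (-1 * g (e - i%:R * h + -1 * t)).
have bounds i t : (i < k)%N -> 0 <= t <= h ->
    [/\ 0 <= i%:R * h, i%:R * h + h <= k%:R * h & 0 <= k%:R * h].
  move=> ik tb; have ik1 : i%:R + 1 <= k%:R :> R by rewrite natr1 ler_nat.
  have i0 := ler0n R i; split; [nra|nra|].
  by rewrite mulr_ge0 // ltW.
have primT : primitive_on 0 h (fun t => \sum_(i < k) T i t)
                              (fun t => \sum_(i < k) T' i t).
  apply: primitive_on_sum => i ik; apply: primitive_onD; last apply: primitive_onZ.
  - apply: (primitive_on_affine primF) => t /andP[t0 th].
      have [] := bounds i t ik; first by rewrite t0.
      by move=> *; rewrite kE; apply/andP; split; lra.
    have [] := bounds i t ik; first by rewrite !ltW.
    by move=> *; rewrite kE; apply/andP; split; lra.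
  - apply: (primitive_on_affine primF) => t /andP[t0 th].
      have [] := bounds i t ik; first by rewrite t0.
      by move=> *; rewrite /e kE; apply/andP; split; lra.
    have [] := bounds i t ik; first by rewrite !ltW.
    by move=> *; rewrite /e kE; apply/andP; split; lra.
have [t /andP[t0 th] TE] := primitive_on_mvt h_gt0 primT.
exists (t / h); first by rewrite divr_gt0 //= ltr_pdivrMr // mul1r.
have -> : F e - F x1 = \sum_(i < k) T i h - \sum_(i < k) T i 0.
  rewrite -sumrB.
  (* The boundary terms of the i-th and the i.+1-th summands cancel. *)
  pose U i := F (x1 + i%:R * h) - F (e - i%:R * h).
  have -> : \sum_(i < k) (T i h - T i 0) = \sum_(i < k) (U i.+1 - U i).
    apply: eq_bigr => i _; rewrite /T /U.
    have -> : x1 + i%:R * h + 1 * h = x1 + i.+1%:R * h by rewrite -natr1; ring.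
    have -> : e - i%:R * h + -1 * h = e - i.+1%:R * h by rewrite -natr1; ring.
    by rewrite !mulr0 !addr0; ring.
  rewrite -(big_mkord xpredT (fun i => U i.+1 - U i)) telescope_sumr //.
  rewrite /U mul0r subr0 addr0.
  have -> : e - k%:R * h = x1 + k%:R * h by rewrite /e kE; ring.
  by rewrite subrr sub0r opprB.
rewrite TE subr0 mulrC; congr (_ * _); apply: eq_bigr => i _; rewrite /T'.
have h_neq0 : h != 0 by rewrite gt_eqF.
have -> : x1 + i%:R * h + 1 * t = x1 + (t / h + i%:R) * h by field.
have -> : e - i%:R * h + -1 * t = x1 + (k.*2%:R - (t / h + i%:R)) * h.
  by rewrite /e; field.
by ring.
Qed.

(** With y_i and z_i mirror images in the i-th interval from the left and from
    the right, W(z_i) = - W(y_i); the folded sum is then minus the alternating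
    sum of |W(y_i)| (q(z_i) - q(y_i)), a product of two nonnegative sequences
    that decrease as i grows.  The strict inequality serves to show that I(w_N)
    is negative. *)
Lemma newton_integral_sign (R : realType) (k : nat) (x1 h : R) (F q : R -> R) :
  let W := newton_poly (node x1 h) k.*2.+1 in
  let e := x1 + k.*2%:R * h in
  0 < h -> primitive_on x1 e F (fun y => W.[y] * q y) ->
  (forall y z, x1 < y -> y < z -> z < e -> W.[y] != 0 -> W.[z] != 0 ->
     q y <= q z) ->
  F e <= F x1 /\
  ((forall y z, x1 < y -> y < z -> z < e -> W.[y] != 0 -> W.[z] != 0 ->
      q y < q z) -> (0 < k)%N -> F e < F x1).
Proof.
move=> W e h_gt0 primF q_nondec.
have [s s01 FE] := folded_primitive h_gt0 primF.
have /andP[s0 s1] := s01.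
have kE : k.*2%:R = k%:R + k%:R :> R by rewrite -addnn natrD.
pose y i := x1 + (s + i%:R) * h.
pose z i := x1 + (k.*2%:R - (s + i%:R)) * h.
pose a i := (-1) ^+ i * falling (s + i%:R) k.*2.+1.
pose r i := q (z i) - q (y i).
have hM : 0 < h ^+ k.*2.+1 by rewrite exprn_gt0.
have Wy i : W.[y i] = h ^+ k.*2.+1 * ((-1) ^+ i * a i).
  by rewrite /W newton_poly_node /a mulrA -exprMn mulrNN mulr1 expr1n mul1r.
have Wz i : W.[z i] = - W.[y i].
  rewrite /W !newton_poly_node falling_reflect -signr_odd /= odd_double.
  by ring.
have {}FE : F e - F x1 = - (h * h ^+ k.*2.+1 * \sum_(i < k) (-1) ^+ i * (a i * r i)).
  rewrite FE -mulrA -mulrN; congr (_ * _).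
  rewrite mulr_sumr -sumrN; apply: eq_bigr => i _.
  by rewrite -/(y i) -/(z i) Wz Wy /r; ring.
have a_gt0 i : (i < k)%N -> 0 < a i.
  by move=> ik; have [] := falling_alternates s01 ik.
have a_dec i : (i.+1 < k)%N -> a i.+1 < a i.
  by move=> ik; have [_ ->] := falling_alternates s01 (ltnW ik).
have Wy_neq0 i : (i < k)%N -> W.[y i] != 0.
  move=> ik; rewrite Wy; apply: mulf_neq0; first by rewrite gt_eqF.
  by apply: mulf_neq0; [rewrite signr_eq0|rewrite gt_eqF ?a_gt0].
have Wz_neq0 i : (i < k)%N -> W.[z i] != 0.
  by move=> ik; rewrite Wz oppr_eq0 Wy_neq0.
have order i : (i < k)%N -> [/\ x1 < y i, y i < z i & z i < e].
  move=> ik; have ik1 : i%:R + 1 <= k%:R :> R by rewrite natr1 ler_nat.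
  have i0 := ler0n R i.
  by rewrite /y /z /e; split; rewrite ?ltrD2l ?ltr_pM2r ?ltrDl ?mulr_gt0 // ?kE; lra.
have order' i : (i.+1 < k)%N -> y i < y i.+1 /\ z i.+1 < z i.
  move=> ik.
  by rewrite /y /z -natr1; split; rewrite ltrD2l ltr_pM2r //; lra.
have r_ge0 i : (i < k)%N -> 0 <= r i.
  move=> ik; have [xy yz ze] := order i ik.
  by rewrite subr_ge0 q_nondec ?Wy_neq0 ?Wz_neq0.
have r_noninc i : (i.+1 < k)%N -> r i.+1 <= r i.
  move=> ik; have [yy zz] := order' i ik.
  have [xy yz ze] := order _ ik; have [xy' yz' ze'] := order _ (ltnW ik).
  apply: lerB; apply: q_nondec; rewrite ?Wy_neq0 ?Wz_neq0 //; try exact: ltnW.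
  - exact: lt_trans yz.
  - exact: lt_trans ze.
have hh : 0 < h * h ^+ k.*2.+1 by rewrite mulr_gt0.
have [k0|k_gt0] := posnP k.
  by rewrite /e k0 mul0r addr0 lexx.
have ar_ge0 i : (i <= k.-1)%N -> 0 <= a i * r i.
  move=> ik; have {}ik : (i < k)%N by lia.
  by rewrite mulr_ge0 ?r_ge0 // ltW ?a_gt0.
have ar_noninc i : (i < k.-1)%N -> a i.+1 * r i.+1 <= a i * r i.
  move=> ik; have {}ik : (i.+1 < k)%N by lia.
  apply: ler_pM; rewrite ?r_noninc ?r_ge0 ?(ltW (a_gt0 _ _)) //.
  exact/ltW/a_dec.
have sumE : \sum_(i < k) (-1) ^+ i * (a i * r i)
            = \sum_(i < k.-1.+1) (-1) ^+ i * (a i * r i).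
  by rewrite prednK.
rewrite {}sumE in FE.
split=> [|q_inc _].
  rewrite -subr_le0 FE oppr_le0; apply: mulr_ge0; first exact: ltW.
  by have /andP[] := alternating_sum_bounds ar_ge0 ar_noninc.
have r0_gt0 : 0 < r 0%N.
  have [xy yz ze] := order 0%N k_gt0.
  by rewrite subr_gt0 q_inc ?Wy_neq0 ?Wz_neq0.
rewrite -subr_lt0 FE oppr_lt0 mulr_gt0 //.
apply: alternating_sum_gt0 ar_ge0 ar_noninc _ _.
  by rewrite mulr_gt0 ?a_gt0.
move=> k1; have {}k1 : (1 < k)%N by lia.
apply: (@le_lt_trans _ _ (a 1%N * r 0%N)).
  by rewrite ler_pM2l ?a_gt0 ?r_noninc.
by rewrite ltr_pM2r ?a_dec.
Qed.

(** * Derivatives within an interval and the generalized Rolle theorem *)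

(** A function d 0 with prescribed successive derivatives within J.  Keeping the
    derivatives as data makes the notion stable under subtracting a polynomial:
    the iterated limits of a difference would first have to be identified. *)
Definition derivative_chain (R : realType) (J : set R) (N : nat)
    (d : nat -> R -> R) : Prop :=
  forall i, (i < N)%N -> forall x, J x ->
    diff_quot (d i) x @ within J x^' --> d i.+1 x.

Lemma Cn_on_derivative_chain (R : realType) (J : set R) (N : nat) (f : R -> R) :
  Cn_on J N f -> derivative_chain J N (fun i => derivn_within J i f).
Proof. by move=> [df _] i iN x Jx; exact: df. Qed.

(** The difference quotient of p at x is the polynomial (p - p(x)) / (X - x), which
    is continuous and whose value at x is p'(x). *)
Lemma diff_quot_horner_cvg (R : realType) (J : set R) (p : {poly R}) (x : R) :
  diff_quot (horner p) x @ within J x^' --> p^`().[x].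
Proof.
have /factor_theorem[r rE] : root (p - p.[x]%:P) x.
  by rewrite rootE !hornerE subrr.
have pE : p = r * ('X - x%:P) + p.[x]%:P by rewrite -rE subrK.
have -> : p^`().[x] = r.[x].
  by rewrite pE derivD derivM derivXsubC derivC !hornerE subrr mulr0 add0r.
move=> V rV.
have nV : nbhs x (fun y => V r.[y]) by exact: (@continuous_horner R r x V rV).
change (nbhs x (fun y => y != x -> J y -> V (diff_quot (horner p) x y))).
apply: filterS nV => y Vy yx _.
suff -> : diff_quot (horner p) x y = r.[y] by [].
rewrite /diff_quot {1}pE !hornerE addrK mulfK // subr_eq0 //.
Qed.

Lemma derivative_chain_sub_poly (R : realType) (J : set R) (N : nat)
    (d : nat -> R -> R) (p : {poly R}) :
  derivative_chain J N d ->
  derivative_chain J N (fun i y => d i y - p^`(i).[y]).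
Proof.
move=> chain i iN x Jx.
have -> : diff_quot (fun y => d i y - p^`(i).[y]) x
          = diff_quot (d i) x \- diff_quot (horner p^`(i)) x.
  by apply/funext => y /=; rewrite /diff_quot -mulrBl; congr (_ * _); ring.
apply: cvgB; first exact: chain.
by rewrite derivnS; exact: diff_quot_horner_cvg.
Qed.

Lemma diff_quot_is_derive (R : realType) (J : set R) (f : R -> R) (x l : R) :
  nbhs x J -> diff_quot f x @ within J x^' --> l -> is_derive x 1 f l.
Proof.
move=> nJ df.
have fl : (fun e => e^-1 *: ((f \o shift x) (e *: 1) - f x)) @ 0^' --> l.
  move=> V /df nV.
  have {}nV : nbhs x (fun y => y != x -> J y -> V (diff_quot f x y)) by exact: nV.
  have sh : (fun e : R => e + x) @ (0 : R) --> x.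
    rewrite -[X in _ --> X]add0r.
    by apply: cvgD; [exact: cvg_id|exact: cvg_cst].
  change (nbhs (0 : R) (fun e => e != 0 ->
            V (e^-1 *: ((f \o shift x) (e *: 1) - f x)))).
  have nV0 : nbhs (0 : R) (fun e => e + x != x -> J (e + x) ->
      V (diff_quot f x (e + x))) by exact: (sh _ nV).
  have nJ0 : nbhs (0 : R) (fun e => J (e + x)) by exact: (sh _ nJ).
  apply: filterS2 nV0 nJ0 => e /= Ve Je e0.
  have := Ve _ Je; rewrite -subr_eq0 addrK => /(_ e0).
  by rewrite /diff_quot /shift /= addrK scaler1 mulrC.
apply: DeriveDef; first by apply/cvg_ex; exists l.
by apply/cvg_lim.
Qed.

Lemma diff_quot_continuous (R : realType) (J : set R) (f : R -> R) (x l : R) :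
  diff_quot f x @ within J x^' --> l -> f @ within J (nbhs x) --> f x.
Proof.
move=> df.
have fx : (fun y => f x + diff_quot f x y * (y - x)) @ within J x^' --> f x.
  rewrite -[X in _ --> X]addr0 -[X in _ + X](mulr0 l) -[X in _ * X](subrr x).
  apply: cvgD; first exact: cvg_cst.
  apply: cvgM => //; apply: cvgB; last exact: cvg_cst.
  move=> V nV.
  change (nbhs x (fun y => y != x -> J y -> V y)).
  by apply: filterS nV.
move=> V nV; have := fx _ nV => nV'.
have {}nV' : nbhs x (fun y => y != x -> J y ->
               V (f x + diff_quot f x y * (y - x))) by exact: nV'.
change (nbhs x (fun y => J y -> V (f y))).
apply: filterS nV' => y Vy Jy.
have [->|yx] := eqVneq y x; first exact: nbhs_singleton nV.
by have := Vy yx Jy; rewrite /diff_quot divfK ?subr_eq0 // addrC subrK.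
Qed.

Lemma rolle_within (R : realType) (a b : R) (f f' : R -> R) (u v : R) :
  (forall x, a <= x <= b -> diff_quot f x @ within `[a, b] x^' --> f' x) ->
  a <= u -> u < v -> v <= b -> f u = 0 -> f v = 0 ->
  exists2 c, u < c < v & f' c = 0.
Proof.
move=> df au uv vb fu fv.
have fder x : x \in `]u, v[%R -> is_derive x 1 f (f' x).
  rewrite in_itv /= => /andP[ux xv].
  apply: (@diff_quot_is_derive _ `[a, b]).
    apply: (@filterS _ _ _ `]u, v[).
      apply: subset_itv; rewrite bnd_simp; first by [].
      by [].
    by apply: near_in_itvoo; rewrite in_itv /= ux.
  by apply: df; rewrite !ltW //; [exact: lt_le_trans vb|exact: le_lt_trans ux].
have fcont : {within `[u, v], continuous f}.
  apply: (@continuous_subspaceW _ _ _ `[a, b]).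
    by apply: subset_itv; rewrite bnd_simp.
  apply/(@subspace_continuousP R `[a, b] R) => x; rewrite /= in_itv /= => xab.
  by apply: diff_quot_continuous; exact: df.
have [] := @Rolle R f u v uv _ fcont _; rewrite ?fu ?fv //.
  by move=> x /fder[].
move=> c cuv [_ <-]; exists c; first by move: cuv; rewrite in_itv.
by have [_ <-] := fder c cuv.
Qed.

(** Recording that the new zeros lie beyond u keeps the list sorted when the
    first interval contributes its own zero. *)
Lemma zeros_of_derivative (R : realType) (a b : R) (f f' : R -> R)
    (u : R) (s : seq R) :
  (forall x, a <= x <= b -> diff_quot f x @ within `[a, b] x^' --> f' x) ->
  path <%R u s -> all (fun x => (a <= x <= b) && (f x == 0)) (u :: s) ->
  exists s', [/\ size s' = size s, path <%R u s' &
                 all (fun x => (a <= x <= b) && (f' x == 0)) s'].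
Proof.
move=> df; elim: s u => [|v s IH] u; first by exists [::].
move=> /= /andP[uv vs] /and3P[/andP[/andP[au ub] /eqP fu] Hv Hs].
have [|s' [szs' ps' as']] := IH v vs; first by rewrite /= Hv.
move: Hv => /andP[/andP[av vb] /eqP fv].
have [c /andP[uc cv] f'c] := rolle_within df au uv vb fu fv.
exists (c :: s'); split=> /=.
- by rewrite szs'.
- rewrite uc /=; case: s' ps' {szs' as'} => //= w s' /andP[vw ->].
  by rewrite (lt_trans cv vw).
by rewrite as' f'c eqxx !andbT (ltW (le_lt_trans au uc)) (ltW (lt_le_trans cv vb)).
Qed.

Lemma generalized_rolle (R : realType) (a b : R) (N : nat)
    (d : nat -> R -> R) (s : seq R) :
  derivative_chain `[a, b] N d -> uniq s -> size s = N.+1 ->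
  all (fun x => (a <= x <= b) && (d 0%N x == 0)) s ->
  exists2 xi, a <= xi <= b & d N xi = 0.
Proof.
move=> chain us; rewrite -(size_sort <=%R s) -(all_sort _ <=%R s).
move: us; rewrite -sort_lt_sorted; move: (sort _ s) => {}s.
elim: N d s chain => [|N IH] d [|u s] chain //= sorted_s [szs] alls.
  move: alls => /andP[/andP[uab /eqP du] _]; by exists u.
have d01 x : a <= x <= b ->
    diff_quot (d 0%N) x @ within `[a, b] x^' --> d 1%N x.
  by move=> xab; apply: chain; rewrite //= in_itv.
have [s' [szs' ps' alls']] := zeros_of_derivative d01 sorted_s alls.
apply: (IH (fun i => d i.+1) s') => //.
- by move=> i iN x Jx; apply: chain.
- exact: path_sorted ps'.
- by rewrite szs'.
Qed.

Lemma derivn_top (R : realType) (n : nat) (p : {poly R}) :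
  (size p <= n.+1)%N -> p^`(n) = (p`_n * n`!%:R)%:P.
Proof.
move=> szp; apply/polyP => i; rewrite coef_derivn coefC.
case: i => [|i] /=; first by rewrite addn0 ffactnn mulr_natr.
by rewrite nth_default ?mul0rn // (leq_trans szp) //; lia.
Qed.

(** When p is the interpolation polynomial of f at distinct x 1, ..., x m, this is
    the divided difference f[x 1, ..., x m, y] as a function of y off the nodes;
    at the nodes it is 0, the value of a division by 0. *)
Definition newton_quotient (R : realType) (x : nat -> R) (m : nat)
    (f : R -> R) (p : {poly R}) (y : R) : R :=
  (f y - p.[y]) / (newton_poly x m).[y].

(** The slope D of the quotient between y and z is the coefficient of degree m + 1
    of the polynomial P of degree at most m + 1 that agrees with d 0 at the m
    nodes, y and z.  The difference d 0 - P has m + 2 zeros, so its derivative of order m + 1,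
    namely d m.+1 - D (m + 1)!, vanishes somewhere. *)
Lemma newton_quotient_slope (R : realType) (a b : R) (m : nat) (x : nat -> R)
    (d : nat -> R -> R) (p : {poly R}) (y z : R) :
  let W := newton_poly x m in
  let q := newton_quotient x m (d 0%N) p in
  derivative_chain `[a, b] m.+1 d -> injective x ->
  (size p <= m)%N ->
  (forall i, (1 <= i <= m)%N -> a <= x i <= b /\ d 0%N (x i) = p.[x i]) ->
  a <= y <= b -> a <= z <= b -> y != z -> W.[y] != 0 -> W.[z] != 0 ->
  exists2 xi, a <= xi <= b & q z - q y = d m.+1 xi / m.+1`!%:R * (z - y).
Proof.
move=> W q chain x_inj szp p_interp yab zab yz Wy Wz.
have zy0 : z - y != 0 by rewrite subr_eq0 eq_sym.
pose D := (q z - q y) / (z - y).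
pose P : {poly R} := p + q y *: W + D *: (W * ('X - y%:P)).
have szW : size W = m.+1 by exact: size_newton_poly.
have szWy : size (W * ('X - y%:P)) = m.+2.
  rewrite size_Mmonic ?monicXsubC ?size_XsubC ?szW ?addn2 //.
  by rewrite -size_poly_eq0 szW.
have Wxi i : (1 <= i <= m)%N -> W.[x i] = 0.
  by move=> im; apply/newton_poly_eq0; exists i.
have szP : (size P <= m.+2)%N.
  rewrite /P (leq_trans (size_polyD _ _)) // geq_max.
  rewrite (leq_trans (size_scale_leq _ _)) ?szWy // andbT.
  rewrite (leq_trans (size_polyD _ _)) // geq_max.
  by rewrite (leq_trans (size_scale_leq _ _)) ?szW // andbT; lia.
have topP : P`_m.+1 = D.
  rewrite /P !coefD !coefZ (nth_default _ (n := m.+1) (s := p)); last lia.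
  rewrite (nth_default _ (s := W)) ?szW // mulr0 addr0 add0r.
  have : W * ('X - y%:P) \is monic.
    by rewrite monicMr ?monicXsubC // monic_newton_poly.
  by move=> /monicP; rewrite /lead_coef szWy => ->; rewrite mulr1.
have chainP := derivative_chain_sub_poly (p := P) chain.
pose s := [:: y, z & [seq x i | i <- iota 1 m]].
have [|||xi xiab] := generalized_rolle (s := s) chainP.
- rewrite /s /= inE negb_or yz map_inj_uniq ?iota_uniq // andbT /=.
  apply/andP; split; apply/negP => /mapP[i]; rewrite mem_iota add1n => im E.
    by move: Wy; rewrite E Wxi ?eqxx //; lia.
  by move: Wz; rewrite E Wxi ?eqxx //; lia.
- by rewrite /= size_map size_iota.
- have qE t : W.[t] != 0 -> d 0%N t = p.[t] + q t * W.[t].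
    by move=> Wt; rewrite /q /newton_quotient divfK // addrC subrK.
  have PE t : P.[t] = p.[t] + q y * W.[t] + D * W.[t] * (t - y).
    by rewrite /P !hornerD !hornerZ hornerM hornerXsubC mulrA.
  rewrite /s /= yab zab !PE /=; apply/and3P; split.
  + by rewrite qE // subrr mulr0 addr0 subrr.
  + rewrite qE // subr_eq0; apply/eqP; rewrite /D; field.
    by rewrite zy0.
  + apply/allP => t /mapP[i]; rewrite mem_iota add1n => im ->.
    have {}im : (1 <= i <= m)%N by lia.
    have [-> fE] := p_interp i im.
    by rewrite PE fE Wxi // !mulr0 mul0r !addr0 subrr eqxx.
rewrite derivn_top // topP hornerC => /eqP; rewrite subr_eq0 => /eqP dE.
by exists xi => //; rewrite dE mulfK ?pnatr_eq0 -?lt0n ?fact_gt0 // /D divfK.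
Qed.

(** * The interpolation error *)

Lemma nodeS (R : realType) (x1 h : R) (m : nat) :
  node x1 h m.+1 = x1 + m%:R * h.
Proof. by rewrite /node -natr1 addrK. Qed.

Lemma node_lt (R : realType) (x1 h : R) (i j : nat) :
  0 < h -> (node x1 h i < node x1 h j) = (i < j)%N.
Proof. by move=> h0; rewrite /node ltrD2l ltr_pM2r // ltrBlDr subrK ltr_nat. Qed.

Lemma node_inj (R : realType) (x1 h : R) : 0 < h -> injective (node x1 h).
Proof.
move=> h0 i j ij; have := node_lt x1 i j h0; have := node_lt x1 j i h0.
by rewrite ij ltxx; lia.
Qed.

(** If n is even there is one more interval, beyond the last zero of W.  There W
    is positive and q - kappa is nonpositive, because q is nondecreasing and
    kappa is its value at the right end; so this interval contributes with the
    same sign as the first M - 1. *)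
Lemma newton_integral_sign_ext (R : realType) (k n : nat) (x1 h kappa : R)
    (F q : R -> R) :
  let x := node x1 h in
  let W := newton_poly x k.*2.+1 in
  0 < h -> n = k.*2.+1 \/ n = k.*2.+2 /\ kappa = q (x n) ->
  primitive_on (x 1%N) (x n) F (fun y => W.[y] * (q y - kappa)) ->
  (forall y z, x 1%N < y -> y < z -> z <= x n -> W.[y] != 0 -> W.[z] != 0 ->
     q y <= q z) ->
  F (x n) <= F (x 1%N) /\
  ((forall y z, x 1%N < y -> y < z -> z <= x n -> W.[y] != 0 -> W.[z] != 0 ->
      q y < q z) -> (2 <= n)%N -> F (x n) < F (x 1%N)).
Proof.
move=> x W h_gt0 nE primF q_nondec.
have xE : x k.*2.+1 = x1 + k.*2%:R * h by rewrite /x nodeS.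
have x1E : x 1%N = x1 by rewrite /x nodeS mul0r addr0.
have x_lt i j : (x i < x j) = (i < j)%N by exact: node_lt.
have xMn : x k.*2.+1 <= x n by rewrite leNgt x_lt; lia.
have [base base_lt] : F (x k.*2.+1) <= F (x 1%N) /\
    ((forall y z, x 1%N < y -> y < z -> z <= x n -> W.[y] != 0 -> W.[z] != 0 ->
        q y < q z) -> (0 < k)%N -> F (x k.*2.+1) < F (x 1%N)).
  have [||le_F lt_F] :=
      @newton_integral_sign R k x1 h F (fun y => q y - kappa) h_gt0.
  - by rewrite -xE; apply: primitive_on_sub primF; rewrite ?x1E.
  - rewrite -xE => y z x1y yz zx Wy Wz; rewrite lerD2r q_nondec ?x1E //.
    by rewrite ltW // (lt_le_trans zx).
  rewrite xE x1E; split=> // q_inc; apply: lt_F.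
  rewrite -xE => y z x1y yz zx Wy Wz; rewrite ltrD2r q_inc //.
  by rewrite ltW // (lt_le_trans zx).
case: nE => [nE|[nE kappaE]].
  rewrite nE in primF q_nondec base_lt *; split=> // q_inc n2.
  by apply: base_lt => //; lia.
have xMn_lt : x k.*2.+1 < x n by rewrite x_lt; lia.
have Wpos t : x k.*2.+1 < t -> 0 < W.[t].
  move=> tM; have -> : t = x1 + ((t - x1) / h) * h by rewrite divfK ?gt_eqF //; ring.
  rewrite /W newton_poly_node mulr_gt0 ?exprn_gt0 // falling_gt0 //.
  by rewrite ltr_pdivlMr // ltrBrDl -xE.
have [t /andP[Mt tn] FE] : exists2 t, x k.*2.+1 < t < x n &
    F (x n) - F (x k.*2.+1) = W.[t] * (q t - kappa) * (x n - x k.*2.+1).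
  apply: primitive_on_mvt => //; apply: primitive_on_sub primF => //.
  by rewrite leNgt x_lt.
have W0 := Wpos _ Mt.
have d0 : 0 < x n - x k.*2.+1 by rewrite subr_gt0.
have xt : x 1%N < t by apply: le_lt_trans Mt; rewrite leNgt x_lt.
have Wn : W.[x n] != 0 by rewrite gt_eqF // Wpos.
split=> [|q_inc n2].
  have qt : q t <= kappa by rewrite kappaE q_nondec // gt_eqF.
  apply: le_trans base; rewrite -subr_le0 FE.
  by rewrite pmulr_lle0 // pmulr_rle0 // subr_le0.
have qt : q t < kappa by rewrite kappaE q_inc // gt_eqF.
apply: lt_le_trans base; rewrite -subr_lt0 FE.
by rewrite pmulr_llt0 // pmulr_rlt0 // subr_lt0.
Qed.

Lemma integral_newton_poly_lt0 (R : realType) (k n : nat) (x1 h : R) :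
  let x := node x1 h in
  0 < h -> n = k.*2.+1 \/ n = k.*2.+2 -> (2 <= n)%N ->
  integral_nodes x n (horner (newton_poly x k.*2.+2)) < 0.
Proof.
move=> x h_gt0 nE n2.
have x1n : x 1%N < x n by rewrite node_lt.
have cW : {within `[x 1%N, x n], continuous (horner (newton_poly x k.*2.+2))}.
  by apply: continuous_subspaceT => t; exact: continuous_horner.
have [F primF FE] := primitive_on_integral x1n cW.
rewrite /integral_nodes FE subr_lt0.
have [|||_] := @newton_integral_sign_ext R k n x1 h (x k.*2.+2) F id h_gt0.
- by case: nE => ->; [left|right].
- apply: primitive_on_eq primF => t _.
  by rewrite newton_polyS hornerM hornerXsubC.
- by move=> y z _ yz *; exact: ltW.
- by apply=> // y z _ yz *.
Qed.

Lemma interpolation_step (R : realType) (x : nat -> R) (m : nat)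
    (f : R -> R) (p : {poly R}) :
  injective x -> (size p <= m)%N ->
  (forall i, (1 <= i <= m)%N -> p.[x i] = f (x i)) ->
  let p' := p + newton_quotient x m f p (x m.+1) *: newton_poly x m in
  (size p' <= m.+1)%N /\
  (forall i, (1 <= i <= m.+1)%N -> p'.[x i] = f (x i)).
Proof.
move=> x_inj szp p_interp p'; split.
  rewrite (leq_trans (size_polyD _ _)) // geq_max (leqW szp) /=.
  by rewrite (leq_trans (size_scale_leq _ _)) // size_newton_poly.
move=> i im; rewrite /p' hornerD hornerZ.
have [->|im'] := eqVneq i m.+1.
  rewrite /newton_quotient divfK; first by rewrite addrC subrK.
  by apply/eqP => /newton_poly_eq0[j jm /x_inj]; lia.
have {}im : (1 <= i <= m)%N by lia.
have -> : (newton_poly x m).[x i] = 0 by apply/newton_poly_eq0; exists i.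
by rewrite mulr0 addr0 p_interp.
Qed.

Lemma interpolation_exists (R : realType) (x : nat -> R) (m : nat)
    (f : R -> R) :
  injective x ->
  exists2 p : {poly R}, (size p <= m)%N &
    forall i, (1 <= i <= m)%N -> p.[x i] = f (x i).
Proof.
move=> x_inj; elim: m => [|m [p szp p_interp]].
  by exists 0; rewrite ?size_poly0 // => i; lia.
have [szp' p'_interp] := interpolation_step x_inj szp p_interp.
by exists (p + newton_quotient x m f p (x m.+1) *: newton_poly x m).
Qed.

Lemma derivative_chain_continuous (R : realType) (a b : R) (N : nat)
    (d : nat -> R -> R) :
  (0 < N)%N -> derivative_chain `[a, b] N d ->
  {within `[a, b], continuous (d 0%N)}.
Proof.
move=> N0 chain; apply/(@subspace_continuousP R `[a, b] R) => x Jx.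
by apply: diff_quot_continuous; exact: chain.
Qed.

(** The bounds are stated for all lower and upper bounds mu of f, so that the
    points where f attains its extrema stay inside this proof. *)
Lemma intermediate_extrema (R : realType) (a b v : R) (f : R -> R) :
  a <= b -> {within `[a, b], continuous f} ->
  (forall mu, (forall t, a <= t <= b -> mu <= f t) -> mu <= v) ->
  (forall mu, (forall t, a <= t <= b -> f t <= mu) -> v <= mu) ->
  exists2 xi, a <= xi <= b & f xi = v.
Proof.
move=> ab cf below above.
have [u uab fu] := EVT_min ab cf; have [w wab fw] := EVT_max ab cf.
have uv : f u <= v by apply: below => t tab; apply: fu; rewrite in_itv.
have vw : v <= f w by apply: above => t tab; apply: fw; rewrite in_itv.
have ivt c d : c \in `[a, b] -> d \in `[a, b] -> c <= d ->
    Num.min (f c) (f d) <= v <= Num.max (f c) (f d) ->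
    exists2 xi, a <= xi <= b & f xi = v.
  rewrite !in_itv /= => /andP[ac _] /andP[_ db] cd vcd.
  have [|xi] := @IVT R f c d v cd _ vcd.
    by apply: continuous_subspaceW cf; apply: subset_itv; rewrite bnd_simp.
  rewrite in_itv /= => /andP[cx xd] fxi.
  by exists xi => //; rewrite (le_trans ac cx) (le_trans xd db).
have [uw|/ltW wu] := leP u w.
  by apply: (ivt u w) => //; rewrite ge_min le_max uv vw orbT.
by apply: (ivt w u) => //; rewrite ge_min le_max uv vw orbT.
Qed.

(** The sign lemma is applied to q - mu id and to mu id - q, for mu a lower or
    an upper bound of d N / N!; dividing by the negative number I(w_N)
    reverses the inequalities. *)
Lemma interpolation_error (R : realType) (k n : nat) (x1 h a b : R)
    (d : nat -> R -> R) :
  let x := node x1 h in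
  let N := k.*2.+2 in
  0 < h -> n = k.*2.+1 \/ n = k.*2.+2 -> (2 <= n)%N ->
  (forall i, (1 <= i <= n)%N -> a <= x i <= b) ->
  derivative_chain `[a, b] N d -> {within `[a, b], continuous (d N)} ->
  exists p : {poly R},
    [/\ (size p <= n)%N,
        forall i, (1 <= i <= n)%N -> p.[x i] = d 0%N (x i) &
        exists2 xi, a <= xi <= b &
          integral_nodes x n (d 0%N) - integral_nodes x n (horner p)
          = integral_nodes x n (horner (newton_poly x N)) / N`!%:R * d N xi].
Proof.
move=> x N h_gt0 nE n2 x_ab chain cdN.
have Mn : (k.*2.+1 <= n)%N by case: nE => ->.
have x_inj : injective x by exact: node_inj.
have x1n : x 1%N < x n by rewrite node_lt.
have /andP[ax1 x1b] : a <= x 1%N <= b by apply: x_ab; lia.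
have /andP[axn xnb] : a <= x n <= b by apply: x_ab; lia.
have ab : a <= b by rewrite (le_trans ax1).
pose f := d 0%N; pose W := newton_poly x k.*2.+1.
have [p0 szp0 p0_interp] := interpolation_exists k.*2.+1 f x_inj.
pose q := newton_quotient x k.*2.+1 f p0.
(* For n even, p is obtained from p0 by one more step of Newton interpolation;
   its new coefficient q (x n) is the constant kappa. *)
have [p [kappa [szp p_interp fpE kappaE]]] : exists p : {poly R}, exists kappa,
    [/\ (size p <= n)%N, forall i, (1 <= i <= n)%N -> p.[x i] = f (x i),
        forall t, f t - p.[t] = (f t - p0.[t]) - kappa * W.[t] &
        n = k.*2.+1 \/ n = k.*2.+2 /\ kappa = q (x n)].
  case: nE => nE; rewrite nE.
    by exists p0, 0; split=> //; [move=> t; rewrite mul0r subr0|left].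
  have [szp p_interp] := interpolation_step x_inj szp0 p0_interp.
  exists (p0 + q (x k.*2.+2) *: W), (q (x k.*2.+2)); split=> //; last by right.
  by move=> t; rewrite hornerD hornerZ; ring.
exists p; split=> //.
have cf : {within `[x 1%N, x n], continuous f}.
  apply: (continuous_subspaceW _ (derivative_chain_continuous _ chain)) => //.
  by apply: subset_itv; rewrite bnd_simp.
have cpoly (r : {poly R}) : {within `[x 1%N, x n], continuous (horner r)}.
  by apply: continuous_subspaceT => t; exact: continuous_horner.
have [F primF FE] := primitive_on_integral x1n cf.
have [P primP PE] := primitive_on_integral x1n (cpoly p).
have [V primV VE] := primitive_on_integral x1n (cpoly (newton_poly x N)).
rewrite /integral_nodes FE PE VE.
set E := _ - _; set c := V (x n) - V (x 1%N).
have c_lt0 : c < 0.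
  by rewrite /c -VE; exact: integral_newton_poly_lt0.
have N_gt0 : 0 < N`!%:R :> R by rewrite ltr0n fact_gt0.
have xnode i : (1 <= i <= n)%N -> a <= x i <= b /\ f (x i) = p.[x i].
  by move=> im; rewrite p_interp // x_ab.
have slope y z : x 1%N < y -> y < z -> z <= x n -> W.[y] != 0 -> W.[z] != 0 ->
    exists2 xi, a <= xi <= b & q z - q y = d N xi / N`!%:R * (z - y).
  move=> xy yz zx Wy Wz.
  apply: (newton_quotient_slope chain x_inj szp0) => //.
  - move=> i im; split; last by rewrite p0_interp.
    by apply: x_ab; move: im => /andP[-> iM]; exact: leq_trans Mn.
  - rewrite !ltW //; last exact: le_lt_trans xy.
    by rewrite (lt_le_trans yz) // (le_trans zx).
  - by rewrite (le_trans zx) // andbT ltW // (lt_trans _ yz) // (le_lt_trans ax1).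
  - by rewrite lt_eqF.
have gE t : f t - p.[t] = W.[t] * (q t - kappa).
  rewrite fpE mulrBr [W.[t] * q t]mulrC /q /newton_quotient -/W.
  have [W0|W0] := eqVneq W.[t] 0; last by rewrite divfK //; ring.
  have fp0 : f t - p0.[t] = 0.
    by have /newton_poly_eq0[i im ->] := W0; rewrite p0_interp // subrr.
  by rewrite fp0 W0 !mulr0 mul0r.
have NE t : (newton_poly x N).[t] = W.[t] * (t - x N).
  by rewrite newton_polyS hornerM hornerXsubC.
(* For r = s q + u id, the constant to be subtracted is s kappa + u x_N; if n is
   even it equals r (x n), since then N = n. *)
have kappaE' s u : n = k.*2.+1 \/ n = k.*2.+2 /\
    s * kappa + u * x N = s * q (x n) + u * x n.
  by case: kappaE => [->|[nE' ->]]; [left|right; rewrite nE'].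
have primE := primitive_onD primF (primitive_onZ (-1) primP).
have below mu : (forall t, a <= t <= b -> mu <= d N t / N`!%:R) -> mu <= E / c.
  move=> mu_le; rewrite ler_ndivlMr //.
  have [||+ _] := newton_integral_sign_ext (q := fun t => 1 * q t + - mu * t)
    h_gt0 (kappaE' 1 (- mu))
    (F := fun t => (F t + -1 * P t) + - mu * V t).
  - apply: primitive_on_eq (primitive_onD primE (primitive_onZ (- mu) primV)).
    by move=> t _; rewrite /= NE mulN1r gE -/W; ring.
  - move=> y z xy yz zx Wy Wz; have [xi xiab qE] := slope _ _ xy yz zx Wy Wz.
    rewrite -subr_ge0; have zy : 0 < z - y by rewrite subr_gt0.
    have -> : 1 * q z + - mu * z - (1 * q y + - mu * y)
              = (d N xi / N`!%:R - mu) * (z - y).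
      by rewrite mulrBl -qE; ring.
    by rewrite mulr_ge0 ?subr_ge0 ?mu_le // ltW.
  rewrite -/x /E /c; lra.
have above mu : (forall t, a <= t <= b -> d N t / N`!%:R <= mu) -> E / c <= mu.
  move=> mu_ge; rewrite ler_ndivrMr //.
  have [||+ _] := newton_integral_sign_ext (q := fun t => -1 * q t + mu * t)
    h_gt0 (kappaE' (-1) mu)
    (F := fun t => -1 * (F t + -1 * P t) + mu * V t).
  - apply: primitive_on_eq (primitive_onD (primitive_onZ (-1) primE)
                                          (primitive_onZ mu primV)).
    by move=> t _; rewrite /= NE [-1 * p.[t]]mulN1r gE -/W; ring.
  - move=> y z xy yz zx Wy Wz; have [xi xiab qE] := slope _ _ xy yz zx Wy Wz.
    rewrite -subr_ge0; have zy : 0 < z - y by rewrite subr_gt0.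
    have -> : -1 * q z + mu * z - (-1 * q y + mu * y)
              = (mu - d N xi / N`!%:R) * (z - y).
      by rewrite mulrBl -qE; ring.
    by rewrite mulr_ge0 ?subr_ge0 ?mu_ge // ltW.
  rewrite -/x /E /c; lra.
have cdN' : {within `[a, b], continuous (fun t => d N t / N`!%:R)}.
  move=> t.
  apply: (@continuousM R (subspace `[a, b]) (d N) (cst N`!%:R^-1) t (cdN t)).
  exact: cst_continuous.
have [xi xiab xiE] := intermediate_extrema ab cdN' below above.
exists xi => //; rewrite -mulrA [_^-1 * _]mulrC xiE.
by rewrite mulrC divfK // lt_eqF.
Qed.

(** * The extended rules *)

Lemma divdiff_eq (R : realType) (f g : R -> R) (x : nat -> R) (i k : nat) :
  (forall j, (i <= j <= i + k)%N -> f (x j) = g (x j)) ->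
  divdiff f x i k = divdiff g x i k.
Proof.
elim: k i => [|k IH] i fg /=; first by rewrite fg // addn0 leqnn.
by rewrite !IH // => j ij; apply: fg; lia.
Qed.

Lemma extended_rule_eq (R : realType) (m : model) (x : nat -> R) (n : nat)
    (wt : nat -> R) (f g : R -> R) :
  (1 <= n)%N -> (forall i, (1 <= i <= n)%N -> f (x i) = g (x i)) ->
  extended_rule m x n wt f = extended_rule m x n wt g.
Proof.
move=> n1 fg; case: m => /=; congr (_ + _).
- by rewrite fg.
- apply: eq_big_nat => j jn; congr (_ * _).
  by apply: divdiff_eq => i ij; apply: fg; lia.
- by apply: eq_big_nat => j jn; rewrite fg //; lia.
- by congr (_ * _); apply: divdiff_eq => i ij; apply: fg; lia.
Qed.

Lemma extended_rule_error (R : realType) (k n : nat) (x1 h a b : R)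
    (m : model) (wt : nat -> R) (d : nat -> R -> R) :
  let x := node x1 h in
  let N := k.*2.+2 in
  let I := integral_nodes x n in
  let S := extended_rule m x n wt in
  0 < h -> n = k.*2.+1 \/ n = k.*2.+2 -> (2 <= n)%N ->
  (forall i, (1 <= i <= n)%N -> a <= x i <= b) ->
  exact_upto I S n.-1 ->
  derivative_chain `[a, b] N d -> {within `[a, b], continuous (d N)} ->
  exists2 xi, a <= xi <= b &
    I (d 0%N) - S (d 0%N) = I (horner (newton_poly x N)) / N`!%:R * d N xi.
Proof.
move=> x N I S h_gt0 nE n2 x_ab S_exact chain cdN.
have [p [szp p_interp [xi xiab err]]] :=
  interpolation_error h_gt0 nE n2 x_ab chain cdN.
exists xi => //; rewrite -err; congr (_ - _).
have -> : integral_nodes x n (horner p) = S (horner p).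
  by apply: S_exact; rewrite prednK //; lia.
by apply: extended_rule_eq => [|i im]; [lia|rewrite p_interp].
Qed.

(** For a polynomial of degree at most N = 2k + 2 the derivative of order N is
    constant, so the error formula evaluates the error exactly: it vanishes in
    degree N - 1 and is I(w_N) < 0 for w_N. *)
Lemma extended_rule_precision (R : realType) (k n : nat) (x1 h a b : R)
    (m : model) (wt : nat -> R) :
  let x := node x1 h in
  let I := integral_nodes x n in
  let S := extended_rule m x n wt in
  0 < h -> n = k.*2.+1 \/ n = k.*2.+2 -> (2 <= n)%N ->
  (forall i, (1 <= i <= n)%N -> a <= x i <= b) ->
  exact_upto I S n.-1 ->
  degree_of_precision I S k.*2.+1.
Proof.
move=> x I S h_gt0 nE n2 x_ab S_exact.
have poly_error (p : {poly R}) : (size p <= k.*2.+3)%N ->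
    I (horner p) - S (horner p)
    = I (horner (newton_poly x k.*2.+2)) * p`_k.*2.+2.
  move=> szp.
  have chain : derivative_chain `[a, b] k.*2.+2 (fun i => horner p^`(i)).
    by move=> i _ t _; rewrite derivnS; exact: diff_quot_horner_cvg.
  have [|xi _ ->] := extended_rule_error h_gt0 nE n2 x_ab S_exact chain.
    by apply: continuous_subspaceT => t; exact: continuous_horner.
  have N_neq0 : (k.*2.+2)`!%:R != 0 :> R by rewrite pnatr_eq0 -lt0n fact_gt0.
  by rewrite derivn_top // hornerC [p`__ * _]mulrC mulrA divfK.
split=> [p szp|e e_exact].
  apply/eqP; rewrite -subr_eq0 poly_error; last exact: leqW.
  by rewrite nth_default // mulr0.
rewrite leqNgt; apply/negP => ke.
have szN : size (newton_poly x k.*2.+2) = k.*2.+3 by rewrite size_newton_poly.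
have IW : I (horner (newton_poly x k.*2.+2)) < 0.
  exact: integral_newton_poly_lt0.
have /eqP : I (horner (newton_poly x k.*2.+2))
            - S (horner (newton_poly x k.*2.+2)) = 0.
  by apply/eqP; rewrite subr_eq0; apply/eqP/e_exact; rewrite szN.
have /monicP := monic_newton_poly x k.*2.+2.
rewrite poly_error ?szN // /lead_coef szN /= => ->.
by rewrite mulr1 lt_eqF.
Qed.

Theorem proposition2p4 (R : realType) (n : nat) (x1 h a b : R) (m : model)
    (wt : nat -> R) (f : R -> R) :
  (2 <= n)%N ->
  0 < h ->
  let x := node x1 h in
  let J : set R := [set` `[a, b]] in
  let I := integral_nodes x n in
  let S := extended_rule m x n wt in
  (forall i : nat, (1 <= i <= n)%N -> J (x i)) ->
  exact_upto I S n.-1 ->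
  (odd n -> Cn_on J n.+1 f ->
     degree_of_precision I S n /\
     exists2 xi : R, J xi &
       I f - S f = I (horner (newton_poly x n.+1)) / (n.+1)`!%:R
                   * derivn_within J n.+1 f xi) /\
  (~~ odd n -> Cn_on J n f ->
     degree_of_precision I S n.-1 /\
     exists2 xi : R, J xi &
       I f - S f = I (horner (newton_poly x n)) / n`!%:R
                   * derivn_within J n f xi).
Proof.
move=> n2 h_gt0 x J I S x_J S_exact.
have x_ab i : (1 <= i <= n)%N -> a <= x i <= b.
  by move=> /x_J; rewrite /J /= in_itv.
(* N = 2k + 2 is n.+1 for odd n and n for even n. *)
suff main k : n = k.*2.+1 \/ n = k.*2.+2 -> Cn_on J k.*2.+2 f ->
    degree_of_precision I S k.*2.+1 /\
    exists2 xi : R, J xi &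
      I f - S f = I (horner (newton_poly x k.*2.+2)) / (k.*2.+2)`!%:R
                  * derivn_within J k.*2.+2 f xi.
  split=> n_odd fC.
    have nE : n = n./2.*2.+1 by rewrite -[LHS]odd_double_half n_odd.
    by have := main n./2 (or_introl nE); rewrite -nE; exact.
  have nE : n = n.-1./2.*2.+2 by lia.
  by have := main n.-1./2 (or_intror nE); rewrite -nE -[_.*2.+1]/(_.+2.-1) -nE; exact.
move=> nE fC; split.
  exact: (extended_rule_precision h_gt0 nE n2 x_ab S_exact).
have [xi xiab err] := extended_rule_error h_gt0 nE n2 x_ab S_exact
  (Cn_on_derivative_chain fC) fC.2.
by exists xi; rewrite // /J /= in_itv.
Qed.
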